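(* Let $\Gamma$ be a finite group and let $\lambda,\mu,\nu\in\mathcal P(\Gamma_* )$. There is a unique polynomial $f_{\lambda\mu}^{\nu}(x)$ such that $f_{\lambda\mu}^\nu(n)=a_{\lambda\mu}^\nu(n)$ for all $n\ge\|\nu\|+\ell(\nu(c^0))$. The degree of the polynomial $f_{\lambda\mu}^\nu(x)$ is the greatest value of $|\mathbb N(\mathcal C)|-|\mathbb N(\mathcal K_\nu)|$ among all (simultaneous $\Gamma_\infty$-)conjugacy classes $\mathcal C$ of pairs $(x,y)\in\Gamma_\infty\times\Gamma_\infty$ such that $x\in\mathcal K_\lambda$, $y\in\mathcal K_\mu$, $xy\in\mathcal K_\nu$.
   Context: $\Gamma_*$ is the set of conjugacy classes of $\Gamma$, and $c^0=\{1\}$. $S_n$ acts on $\Gamma^n$ by $\sigma(g_1,\dots,g_n)=(g_{\sigma^{-1}(1)},\dots,g_{\sigma^{-1}(n)})$, and $\Gamma_n=\Gamma^n\rtimes S_n$ with $(g,\sigma)(h,\tau)=(g\,\sigma(h),\sigma\tau)$. $\Gamma_n$ embeds in $\Gamma_{n+1}$ as $\Gamma_n\times 1$, and $\Gamma_\infty=\bigcup_{n\ge1}\Gamma_n$. For $x=(g,\sigma)$ and a cycle $(i_1\cdots i_k)$ of $\sigma$ (fixed points are 1-cycles), the cycle-product is $g_{i_k}\cdots g_{i_1}$, well defined up to conjugacy. $\mathcal P(\Gamma_* )$ is the set of partition-valued functions on $\Gamma_*$; $\|\lambda\|=\sum_c|\lambda(c)|$, and $\ell$ denotes the number of parts of a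 partition. The type $\rho$ of $x\in\Gamma_n$: the number of parts of $\rho(c)$ equal to $i$ is the number of $i$-cycles of $\sigma$ with cycle-product in $c$. The modified type $\lambda$: $\lambda(c)=\rho(c)$ for $c\ne c^0$, and $\lambda(c^0)$ is obtained from $\rho(c^0)$ by subtracting 1 from every part (zeros discarded). Two elements of $\Gamma_\infty$ are conjugate iff their modified types coincide; $\mathcal K_\lambda$ is the conjugacy class in $\Gamma_\infty$ of elements of modified type $\lambda$. $K_\lambda(n)\in\mathbb Z[\Gamma_n]$ is the sum of all elements of $\Gamma_n\cap\mathcal K_\lambda$; it is nonzero iff $\|\lambda\|+\ell(\lambda(c^0))\le n$, and the nonzero ones form a $\mathbb Z$-basis of the center $R_\mathbb{Z}(\Gamma_n)$ of $\mathbb Z[\Gamma_n]$. $a_{\lambda\mu}^\nu(n)$ is defined by $K_\lambda(n)K_\mu(n)=\sum_\nu a_{\lambda\mu}^\nu(n)K_\nu(n)$ (uniquely determined for $n\ge\|\nu\|+\ell(\nu(c^0))$). For a set $Y$ of elements of $\Gamma_\infty$, $\mathbb N(Y)=\{j\ge 1\mid \sigma(j)\ne j \text{ or } g_j\ne1\text{ for some } ((g_1,g_2,\dots),\sigma)\in Y\}$. Two $r$-tuples in $\Gamma_\infty$ are conjugate if some $z\in\Gamma_\infty$ conjugates one to the other componentwise. For a conjugacy class $\mathcal C$ of $r$-tuples, $|\mathbb N(\mathcal C)|$ is the cardinality of $\mathbb N(\{x_1,\dots,x_r\})$ for any $(x_1,\dots,x_r)\in\mathcal C$; in particular $|\mathbb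 N(\mathcal K_\nu)|=\|\nu\|+\ell(\nu(c^0))$. *)

(* Defs.v *)
From HB Require Import structures.
From mathcomp Require Import all_boot all_order all_algebra all_fingroup.
From mathcomp Require Import finmap.
From mathcomp Require Import mathcomp_extra boolp classical_sets functions.
From mathcomp Require Import cardinality fsbigop.

Set Implicit Arguments.
Unset Strict Implicit.
Unset Printing Implicit Defensive.

Import Order.TTheory GRing.Theory Num.Theory.
Local Open Scope group_scope.

Record intpart := IntPart {
  parts :> seq nat;
  partsP : sorted geq parts && (0 \notin parts) }.

HB.instance Definition _ := [isSub for parts].
HB.instance Definition _ := [Choice of intpart by <:].

Lemma mkpart_subproof (s : seq nat) :
  sorted geq (sort geq [seq i <- s | i != 0]) &&
  (0 \notin sort geq [seq i <- s | i != 0]).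
Proof.
apply/andP; split; first by apply: sort_sorted => i j; apply: leq_total.
by rewrite mem_sort mem_filter.
Qed.

Definition mkpart (s : seq nat) : intpart := IntPart (mkpart_subproof s).

Lemma count_mkpart (s : seq nat) (i : nat) :
  0 < i -> count_mem i (mkpart s) = count_mem i s.
Proof.
move=> i_gt0; rewrite /= count_sort count_filter; apply: eq_count => j /=.
by case: eqP => //= ->; rewrite -lt0n i_gt0.
Qed.

Section Types.
Variable gT : finGroupType.

Definition conjcl := {c : {set gT} | c \in classes [set: gT]}.

Lemma conjcl1_subproof : [set 1] \in classes [set: gT].
Proof. by rewrite classes1. Qed.

Definition conjcl1 : conjcl := exist _ [set 1] conjcl1_subproof.

Definition ptypes := {ffun conjcl -> intpart}.

Definition pnorm (lam : ptypes) : nat := \sum_(c : conjcl) sumn (lam c).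

(* Γ^n ⋊ S_n for Γ = gT. *)
Record wreath (n : nat) := Wreath { wcoord : {ffun 'I_n -> gT}; wperm : 'S_n }.

Definition wreath_pair n (x : wreath n) := (wcoord x, wperm x).
Definition pair_wreath n (p : {ffun 'I_n -> gT} * 'S_n) := Wreath p.1 p.2.
Lemma wreath_pairK n : cancel (@wreath_pair n) (@pair_wreath n).
Proof. by case. Qed.
HB.instance Definition _ n := Finite.copy (wreath n) (can_type (@wreath_pairK n)).

(* mathcomp's product of permutations composes from left to right,
   so the composite function σ ∘ τ is the product τ * σ. *)
Definition wmul n (x y : wreath n) : wreath n :=
  Wreath [ffun i => wcoord x i * wcoord y ((wperm x)^-1 i)]
         (wperm y * wperm x).
Definition wone n : wreath n := Wreath [ffun=> 1] 1.
Definition winv n (x : wreath n) : wreath n :=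
  Wreath [ffun i => (wcoord x (wperm x i))^-1] (wperm x)^-1.

Lemma wmulA n : associative (@wmul n).
Proof.
move=> x y z; congr Wreath; last by rewrite mulgA.
by apply/ffunP => i; rewrite !ffunE /= invMg permM mulgA.
Qed.
Lemma wmul1 n : left_id (@wone n) (@wmul n).
Proof.
case=> g s; congr Wreath; last by rewrite mulg1.
by apply/ffunP => i; rewrite !ffunE /= invg1 perm1 mul1g.
Qed.
Lemma wmulV n : left_inverse (@wone n) (@winv n) (@wmul n).
Proof.
case=> g s; congr Wreath; last by rewrite mulgV.
by apply/ffunP => i; rewrite !ffunE /= invgK mulVg.
Qed.
HB.instance Definition _ n :=
  Finite_isGroup.Build (wreath n) (@wmulA n) (@wmul1 n) (@wmulV n).

(* For the cycle (i_1 ... i_k) with i_1 = i and i_(j+1) = σ(i_j), this is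
   g_(i_k) * ... * g_(i_1). *)
Definition cycle_product n (x : wreath n) (i : 'I_n) : gT :=
  \prod_(j <- rev (traject (wperm x) i #|porbit (wperm x) i|)) wcoord x j.

Lemma cycle_product_conj n (x : wreath n) (i : 'I_n) :
  cycle_product x (wperm x i) = cycle_product x i ^ (wcoord x i)^-1.
Proof.
have porbE: porbit (wperm x) (wperm x i) = porbit (wperm x) i.
  by have := porbit_perm (wperm x) 1 i; rewrite expg1.
rewrite /cycle_product porbE; have := iter_porbit (wperm x) i.
have: 0 < #|porbit (wperm x) i| by apply/card_gt0P; exists i; apply: porbit_id.
case: #|_| => // k _ ki.
rewrite trajectSr -iterSr ki trajectS rev_rcons rev_cons big_cons.
by rewrite -cats1 big_cat big_seq1 conjgE invgK mulgK.
Qed.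

(* Independent of i in the cycle A, by cycle_product_conj. *)
Definition cycle_in n (x : wreath n) (A : {set 'I_n}) (c : conjcl) : bool :=
  [exists i in A, cycle_product x i \in val c].

Definition ctype n (x : wreath n) : ptypes :=
  [ffun c => mkpart
     [seq #|A| | A : {set 'I_n} <- enum (porbits (wperm x)) & cycle_in x A c]].

Definition mtype n (x : wreath n) : ptypes :=
  [ffun c => if c == conjcl1 then mkpart [seq r.-1 | r <- ctype x c]
             else ctype x c].

Lemma count_ctype n (x : wreath n) (c : conjcl) (r : nat) : 0 < r ->
  count_mem r (ctype x c) =
  #|[set A in porbits (wperm x) | cycle_in x A c & #|A| == r]|.
Proof.
move=> r_gt0; rewrite ffunE count_mkpart // count_map count_filter -size_filter cardE.
apply/perm_size/uniq_perm; rewrite ?filter_uniq -?enumT ?enum_uniq // => A.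
by rewrite mem_filter !mem_enum !inE /= andbC [_ && cycle_in _ _ _]andbC.
Qed.

End Types.

(* Elements of Γ_∞ as pairs (g, σ) on the 0-based index set nat which are trivial
   from some index on. The inverse gpermV of σ is data, but is determined by σ
   (ginfP); embed_union below shows that this is the union of the Γ_n. *)
Record ginf (gT : finGroupType) := Ginf {
  gcoord : nat -> gT;
  gperm : nat -> nat;
  gpermV : nat -> nat;
  gpermK : cancel gperm gpermV;
  gpermVK : cancel gpermV gperm;
  gbounded : exists n, forall j, n <= j -> gcoord j = 1 /\ gperm j = j }.

Section GammaInfty.
Variable gT : finGroupType.
Implicit Types x y z : ginf gT.

HB.instance Definition _ := gen_eqMixin (ginf gT).
HB.instance Definition _ := gen_choiceMixin (ginf gT).

Lemma ginfP x y : gcoord x =1 gcoord y -> gperm x =1 gperm y -> x = y.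
Proof.
case: x y => g s t st ts b [g' s' t' st' ts' b'] /= /funext gg /funext ss.
subst g' s'.
have tt : t = t' by apply/funext => j; rewrite -{1}[j]ts' st.
subst t'.
by rewrite (Prop_irrelevance st st') (Prop_irrelevance ts ts')
  (Prop_irrelevance b b').
Qed.

Lemma gmul_subproof x y : exists n, forall j, n <= j ->
  gcoord x j * gcoord y (gpermV x j) = 1 /\ gperm x (gperm y j) = j.
Proof.
have [[m xm] [n yn]] := (gbounded x, gbounded y).
exists (maxn m n) => j; rewrite geq_max => /andP[mj nj].
have [xj sj] := xm _ mj; have [yj tj] := yn _ nj.
by rewrite -{2}sj gpermK xj yj tj sj mulg1.
Qed.
Definition gmul x y : ginf gT :=
  Ginf (can_comp (gpermK x) (gpermK y)) (can_comp (gpermVK y) (gpermVK x))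
       (gmul_subproof x y).

Lemma gone_subproof : exists n : nat, forall j, n <= j -> (1 : gT) = 1 /\ j = j.
Proof. by exists 0. Qed.
Definition gone : ginf gT :=
  @Ginf gT (fun=> 1) id id (fun=> erefl) (fun=> erefl) gone_subproof.

Lemma ginv_subproof x : exists n, forall j, n <= j ->
  (gcoord x (gperm x j))^-1 = 1 /\ gpermV x j = j.
Proof.
have [n xn] := gbounded x; exists n => j nj.
have [xj sj] := xn _ nj.
by rewrite sj xj invg1; split=> //; rewrite -{1}sj gpermK.
Qed.
Definition ginv x : ginf gT :=
  Ginf (gpermVK x) (gpermK x) (ginv_subproof x).

Lemma gmulA : associative gmul.
Proof. by move=> x y z; apply: ginfP => j //=; rewrite mulgA. Qed.
Lemma gmul1 : left_id gone gmul.
Proof. by move=> x; apply: ginfP => j //=; rewrite mul1g. Qed.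
Lemma gmulg1 : right_id gone gmul.
Proof. by move=> x; apply: ginfP => j //=; rewrite mulg1. Qed.
Lemma gmulV : left_inverse gone ginv gmul.
Proof.
by move=> x; apply: ginfP => j /=; [rewrite mulVg | rewrite gpermK].
Qed.
Lemma gmulgV : right_inverse gone ginv gmul.
Proof.
by move=> x; apply: ginfP => j /=; rewrite gpermVK // mulgV.
Qed.
HB.instance Definition _ :=
  isGroup.Build (ginf gT) gmulA gmul1 gmulg1 gmulV gmulgV.

Definition ext_coord n (g : {ffun 'I_n -> gT}) (j : nat) : gT :=
  if insub j is Some i then g i else 1.

Definition ext_perm n (s : 'S_n) (j : nat) : nat :=
  if insub j is Some i then val (s i) else j.

Lemma ext_permK n (s : 'S_n) : cancel (ext_perm s) (ext_perm s^-1).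
Proof.
move=> j; rewrite {2}/ext_perm; case: insubP => [i _ <-|j_ge].
  by rewrite /ext_perm valK permK.
by rewrite /ext_perm insubN.
Qed.

Lemma embed_subproof n (x : wreath gT n) : exists m, forall j, m <= j ->
  ext_coord (wcoord x) j = 1 /\ ext_perm (wperm x) j = j.
Proof.
by exists n => j; rewrite leqNgt => nj; rewrite /ext_coord /ext_perm insubN.
Qed.

Lemma ext_permVK n (s : 'S_n) : cancel (ext_perm s^-1) (ext_perm s).
Proof. by rewrite -{2}[s]invgK; apply: ext_permK. Qed.

Definition embed n (x : wreath gT n) : ginf gT :=
  Ginf (ext_permK (wperm x)) (ext_permVK (wperm x)) (embed_subproof x).

Lemma embedM n (x y : wreath gT n) : embed (x * y) = embed x * embed y.
Proof.
apply: ginfP => j /=; rewrite /ext_coord /ext_perm.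
  case: insubP => [i _ _|j_ge]; last by rewrite insubN // mulg1.
  by rewrite valK ffunE.
case: insubP => [i _ _|j_ge]; last by rewrite insubN.
by rewrite valK permM.
Qed.

Lemma embed_inj n : injective (@embed n).
Proof.
case=> g s [h t] eq_gh; congr Wreath.
  apply/ffunP => i; have := congr1 (fun x => gcoord x i) eq_gh.
  by rewrite /= /ext_coord !valK.
apply/permP => i; apply: val_inj.
by have := congr1 (fun x => gperm x i) eq_gh; rewrite /= /ext_perm !valK.
Qed.

Lemma embed_union x : exists n (y : wreath gT n), embed y = x.
Proof.
have [n xn] := gbounded x; exists n.
have lt_n (i : 'I_n) : gperm x i < n.
  rewrite ltnNge; apply/negP => ni; have [_ /(can_inj (gpermK x)) xi] := xn _ ni.
  by move: (ltn_ord i); rewrite ltnNge -xi ni.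
have inj_s : injective (fun i : 'I_n => Ordinal (lt_n i)).
  by move=> i j [] /(can_inj (gpermK x)) /val_inj.
exists (Wreath [ffun i : 'I_n => gcoord x i] (perm inj_s)).
apply: ginfP => j /=; rewrite /ext_coord /ext_perm.
  by case: insubP => [i _ <-|]; rewrite ?ffunE // -leqNgt => /xn[].
by case: insubP => [i _ <-|]; rewrite ?permE // -leqNgt => /xn[].
Qed.

Local Open Scope classical_set_scope.

Definition Kinf (lam : ptypes gT) : set (ginf gT) :=
  [set x | exists n (y : wreath gT n), embed y = x /\ mtype y = lam].

Definition Nset (Y : set (ginf gT)) : set nat :=
  [set j | exists2 x, Y x & gperm x j <> j \/ gcoord x j <> 1].

Definition tconj r (t : r.-tuple (ginf gT)) z : r.-tuple (ginf gT) :=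
  [tuple of [seq x ^ z | x <- t]].

Definition tclass r (C : set (r.-tuple (ginf gT))) : Prop :=
  exists t, C = [set tconj t z | z in setT].

Definition Ncard r (t : r.-tuple (ginf gT)) : nat :=
  #|` fset_set (Nset [set` t])|.

(* For conjugacy classes this does not depend on the representative (NclassE). *)
Definition Nclass r (C : set (r.-tuple (ginf gT))) : nat :=
  Ncard (xget [tuple of nseq r 1] C).

Lemma Nset_finite r (t : r.-tuple (ginf gT)) : finite_set (Nset [set` t]).
Proof.
pose N1 x := [set j | gperm x j <> j \/ gcoord x j <> 1].
apply: (@sub_finite_set _ _ (\bigcup_(x in [set` t]) N1 x)).
  by move=> j [x tx xj]; exists x.
apply: bigcup_finite; first exact: finite_seq.
move=> x _; have [n xn] := gbounded x.
apply: (@sub_finite_set _ _ `I_n) => // j /= xj.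
by rewrite ltnNge; apply/negP => /xn[cj sj]; case: xj.
Qed.

Lemma Ncard_conj r (t : r.-tuple (ginf gT)) z : Ncard (tconj t z) = Ncard t.
Proof.
have fixE x j : (gperm (x ^ z) j <> j \/ gcoord (x ^ z) j <> 1) <->
    (gperm x (gperm z j) <> gperm z j \/ gcoord x (gperm z j) <> 1).
  rewrite -!not_andE; split; apply: contra_not; rewrite /= => -[sj cj].
    have xj : gpermV x (gperm z j) = gperm z j by rewrite -{1}sj gpermK.
    by rewrite sj gpermK cj xj mul1g mulVg.
  have sj' : gperm x (gperm z j) = gperm z j by rewrite -{2}sj gpermVK.
  have xj : gpermV x (gperm z j) = gperm z j by rewrite -{1}sj' gpermK.
  split=> //; move: cj; rewrite xj => cj.
  by apply: (@conjg_inj _ (gcoord z (gperm z j))); rewrite conj1g conjgE.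
have NE : Nset [set` tconj t z] = gpermV z @` Nset [set` t].
  apply/seteqP; split=> [j [_ /mapP[x tx ->] /fixE xj]|_ [j [x tx xj] <-]].
    by exists (gperm z j); [exists x | rewrite gpermK].
  exists (x ^ z); first exact: map_f.
  by apply/fixE; rewrite gpermVK.
rewrite /Ncard NE fset_set_image; last exact: Nset_finite.
by rewrite card_imfset //; apply: can_inj (gpermVK z).
Qed.

Lemma NclassE r (C : set (r.-tuple (ginf gT))) t :
  tclass C -> C t -> Nclass C = Ncard t.
Proof.
case=> u ->; rewrite /Nclass; case: xgetP => [v _ [z _ <-]|noC [z _ <-]].
  by move=> [z' _ <-]; rewrite !Ncard_conj.
by have /(_ u) := noC; case; exists 1 => //; apply: val_inj; rewrite /= (eq_map (@conjg1 _)) map_id.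
Qed.

Local Open Scope ring_scope.

Definition gring (hT : finGroupType) := {ffun hT -> int}.

Definition gbasis (hT : finGroupType) (x : hT) : gring hT :=
  [ffun y => (y == x)%:R].

Definition gconv (hT : finGroupType) (u v : gring hT) : gring hT :=
  [ffun z => \sum_(p : hT * hT | (p.1 * p.2)%g == z) u p.1 * v p.2].

Lemma gconv_basis (hT : finGroupType) (x y : hT) :
  gconv (gbasis x) (gbasis y) = gbasis (x * y)%g.
Proof.
apply/ffunP => z; rewrite !ffunE big_mkcond (bigD1 (x, y)) //= big1 ?addr0.
  by rewrite !ffunE !eqxx mulr1 eq_sym; case: eqP.
move=> [x' y'] /=; rewrite xpair_eqE negb_and !ffunE => xy.
by case: eqP => // _; case/orP: xy => /negPf ->; rewrite ?mul0r ?mulr0.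
Qed.

Definition Ksum n (lam : ptypes gT) : gring (wreath gT n) :=
  \sum_(x : wreath gT n | `[< Kinf lam (embed x) >]) gbasis x.

(* The \in sum is over the finite support: Ksum n nu is nonzero for only
   finitely many nu. *)
Definition structure_consts n (lam mu : ptypes gT) : set (ptypes gT -> int) :=
  [set a | gconv (Ksum n lam) (Ksum n mu) =
           \sum_(nu \in setT) Ksum n nu *~ a nu].

(* The value at nu is determined when Ksum n nu is nonzero, and arbitrary
   otherwise. *)
Definition structure_const n (lam mu nu : ptypes gT) : int :=
  xget (fun=> 0) (structure_consts n lam mu) nu.

Definition pair_class (lam mu nu : ptypes gT) : set (set (2.-tuple (ginf gT))) :=
  [set C | tclass C /\
    forall x y, C [tuple x; y] ->
      [/\ Kinf lam x, Kinf mu y & Kinf nu (x * y)%g]].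

Definition Kclass (nu : ptypes gT) : set (1.-tuple (ginf gT)) :=
  [set [tuple x] | x in Kinf nu].

End GammaInfty.

(* Main.v *)
Require Import Defs.
From mathcomp Require Import all_boot all_order all_algebra all_fingroup.
From mathcomp Require Import finmap.
From mathcomp Require Import boolp classical_sets cardinality fsbigop.

(** Write N(ν) for ‖ν‖ + ℓ(ν(c⁰)), the number of points moved or labelled
    nontrivially by any element of K_ν ([pweight] below).

    Comparing coefficients at a fixed z of modified type ν shows that
    a_{λμ}^ν(n) is the number of x in Γ_n with x in K_λ and x⁻¹z in K_μ
    ([structure_const_factors]). This needs that modified types classify
    conjugacy in Γ_n ([mtype_conj], [eq_mtype_conj]), and the comparison
    determines the coefficient for all n ≥ N(ν) because K_ν has an element z
    in Γ_N(ν), which may be chosen without trivial points ([mtype_exists]).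

    Fix such a z, and sort the x counted in Γ_(N(ν)+m) by the set S of indices
    beyond N(ν) that x does not fix with trivial label. Since z is trivial
    beyond N(ν), the pair (x, x⁻¹z) has support {0..N(ν)-1} ∪ S. Carrying
    elements along the injection which is the identity below N(ν) and lists S
    beyond shows that the number of x with given S depends only on k = |S|;
    call it c_k ([card_outer]). Hence a_{λμ}^ν(n) = Σ_k c_k C(n - N(ν), k)
    ([card_factors]). As k ≤ |supp x| = N(λ), the sum is bounded and is a
    polynomial in n; as the binomials have distinct degrees, its degree is the
    greatest k with c_k ≠ 0.

    Finally, c_k ≠ 0 iff some class of pairs (x, y) with x in K_λ, y in K_μ
    and xy in K_ν has support of size N(ν) + k: a pair in such a class can be
    conjugated so that xy = z ([outer_count_pair_class],
    [pair_class_outer_count]).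

    The classification of conjugacy is done for labelled permutations, that is,
    a permutation s of a finite set T with a label g(t) in Γ for each t in T.
    Such data are determined up to isomorphism by the numbers of cycles of each
    length and class of cycle product ([labelled_perm_iso]). *)

Set Implicit Arguments.
Unset Strict Implicit.
Unset Printing Implicit Defensive.

Import Order.TTheory GRing.Theory Num.Theory.
Local Open Scope group_scope.

(** * Labelled permutations of a finite set *)

Lemma iter_porbitD (T : finType) (s : {perm T}) (t : T) (q : nat) :
  iter q s t = iter (q %% #|porbit s t|) s t.
Proof.
rewrite {1}(divn_eq q #|porbit s t|) addnC iterD; congr iter.
by elim: (q %/ _) => // d IHd; rewrite mulSn iterD IHd iter_porbit.
Qed.

Lemma eq_iter_porbit (T : finType) (s : {perm T}) (t : T) (p q : nat) :
  iter p s t = iter q s t -> p = q %[mod #|porbit s t|].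
Proof.
have L_gt0 : 0 < #|porbit s t| by rewrite lt0n card_porbit_neq0.
rewrite (iter_porbitD s t p) (iter_porbitD s t q) => /eqP.
rewrite -(nth_traject s (ltn_pmod p L_gt0)) -(nth_traject s (ltn_pmod q L_gt0)).
by rewrite nth_uniq ?size_traject ?uniq_traject_porbit ?ltn_mod // => /eqP.
Qed.

Lemma porbit1 (T : finType) (s : {perm T}) (t : T) :
  porbit s (s t) = porbit s t.
Proof. by have := porbit_perm s 1 t; rewrite expg1. Qed.

Lemma porbit_fixed (T : finType) (s : {perm T}) (t : T) :
  s t = t -> porbit s t = [set t].
Proof.
move=> st; apply/setP => u; rewrite inE; apply/porbitP/eqP => [[i ->]|->].
  by rewrite permX; elim: i => //= i ->.
by exists 0; rewrite expg0 perm1.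
Qed.

(** The key of a fixed point with trivial label. *)
Definition key1 (gT : finGroupType) : nat * {set gT} := (1%N, [set 1]).

Section Cocycle.
Variables (gT : finGroupType) (T : finType).
Implicit Types (s : {perm T}) (g : T -> gT) (t : T).

(** The product g(s^(m-1) t) ... g(s t) g(t) of the labels met in m steps
    from t. *)
Definition cocyc (s : T -> T) g (m : nat) t : gT :=
  \prod_(j <- rev (traject s t m)) g j.

Lemma cocyc0 s g t : cocyc s g 0 t = 1.
Proof. by rewrite /cocyc big_nil. Qed.

Lemma cocycS s g m t : cocyc s g m.+1 t = g (iter m s t) * cocyc s g m t.
Proof. by rewrite /cocyc trajectSr rev_rcons big_cons. Qed.

Lemma cocycD s g m n t :
  cocyc s g (m + n) t = cocyc s g m (iter n s t) * cocyc s g n t.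
Proof.
elim: m => [|m IHm]; first by rewrite cocyc0 mul1g.
by rewrite addSn !cocycS IHm mulgA -iterD.
Qed.

(** The key of a point: the length of its cycle, and the conjugacy class of
    the product of the labels along that cycle. *)
Definition ckey s g t : nat * {set gT} :=
  (#|porbit s t|, cocyc s g #|porbit s t| t ^: [set: gT]).

Lemma cocyc_porbitD s g t (q : nat) (L := #|porbit s t|) :
  cocyc s g q t = cocyc s g (q %% L) t * cocyc s g L t ^+ (q %/ L).
Proof.
have iterM d : iter (d * L) s t = t.
  by rewrite iter_porbitD modnMl.
rewrite {1}(divn_eq q L) addnC cocycD iterM; congr (_ * _).
elim: (q %/ L) => [|d IHd]; first by rewrite mul0n cocyc0.
by rewrite mulSn cocycD iterM IHd expgS.
Qed.

Lemma ckey_fixed s g t : s t = t -> g t = 1 -> ckey s g t = key1 gT.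
Proof.
move=> st gt; rewrite /ckey porbit_fixed // cards1 cocycS cocyc0 /= gt mulg1.
by rewrite class1G.
Qed.

(** The number of points of given key. *)
Definition pcount s g (k : nat * {set gT}) : nat :=
  #|[set t | ckey s g t == k]|.

(** The key of a cycle, read off at any of its points (and junk on the empty
    set). *)
Definition okey s g (A : {set T}) : nat * {set gT} :=
  if [pick t in A] is Some t then ckey s g t else (0, finset.set0).

(** The number of cycles of given key. *)
Definition ocount s g (k : nat * {set gT}) : nat :=
  #|[set A in porbits s | okey s g A == k]|.

End Cocycle.

Section Transport.
Variables (gT : finGroupType) (T T' : finType).
Variables (s : {perm T}) (g : T -> gT) (s' : {perm T'}) (g' : T' -> gT).
Variables (tau : T -> T') (k : T -> gT).
Hypothesis tau_inj : injective tau.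
Hypothesis tau_s : forall t, tau (s t) = s' (tau t).
Hypothesis k_s : forall t, k (s t) * g t = g' (tau t) * k t.

Lemma iter_transport q t : iter q s' (tau t) = tau (iter q s t).
Proof. by elim: q => //= q ->. Qed.

Lemma porbit_transport t : porbit s' (tau t) = tau @: porbit s t.
Proof.
apply/setP => u; apply/porbitP/imsetP => [[i ->]|[v /porbitP[i ->] ->]].
  by exists ((s ^+ i) t); rewrite ?mem_porbit // !permX iter_transport.
by exists i; rewrite !permX iter_transport.
Qed.

Lemma cocyc_transport q t :
  cocyc s' g' q (tau t) = k (iter q s t) * cocyc s g q t * (k t)^-1.
Proof.
elim: q => [|q IHq]; first by rewrite !cocyc0 mulg1 mulgV.
by rewrite !cocycS IHq iter_transport !mulgA -k_s.
Qed.

Lemma ckey_transport t : ckey s' g' (tau t) = ckey s g t.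
Proof.
rewrite /ckey porbit_transport card_imset // cocyc_transport iter_porbit.
by rewrite -{1}[k t]invgK -mulgA -conjgE classGidl ?inE.
Qed.

(** Cycles of length 1 with trivial label are invisible to the embedding tau,
    all others are counted alike. *)
Lemma pcount_transport :
    (forall u, u \notin codom tau -> s' u = u /\ g' u = 1) ->
  forall c, c != key1 gT -> pcount s' g' c = pcount s g c.
Proof.
move=> triv c cN1; rewrite /pcount -(card_imset _ tau_inj); apply/eq_card => u.
rewrite inE; apply/eqP/imsetP => [uc|[t]]; last first.
  by rewrite inE => /eqP <- ->; apply: ckey_transport.
case: (boolP (u \in codom tau)) => [/codomP[t ut]|/triv[su gu]].
  by exists t => //; rewrite inE -ckey_transport -ut uc.
by rewrite -uc ckey_fixed ?eqxx in cN1.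
Qed.

End Transport.

Section Keys.
Variables (gT : finGroupType) (T : finType) (s : {perm T}) (g : T -> gT).

Lemma ckey_perm t : ckey s g (s t) = ckey s g t.
Proof. by apply: (@ckey_transport _ _ _ s g s g s g) => // u v /perm_inj. Qed.

Lemma ckey_porbit t u : u \in porbit s t -> ckey s g u = ckey s g t.
Proof.
by case/porbitP=> i ->; rewrite permX; elim: i => //= i <-; rewrite ckey_perm.
Qed.

Lemma okey_porbit t : okey s g (porbit s t) = ckey s g t.
Proof.
rewrite /okey; case: pickP => [u /ckey_porbit //|/(_ t)].
by rewrite porbit_id.
Qed.

Lemma pcount_ocount c : pcount s g c = (ocount s g c * c.1)%N.
Proof.
have imE : porbit s @: [set t | ckey s g t == c]
    = [set A in porbits s | okey s g A == c].
  apply/setP => A; rewrite inE; apply/imsetP/andP => [[t]|[/imsetP[t _ ->]]].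
    by rewrite inE => /eqP tc ->; rewrite imset_f // okey_porbit tc.
  by rewrite okey_porbit => tc; exists t; rewrite ?inE.
rewrite /pcount -sum1_card (partition_big_imset (porbit s)) /= imE.
rewrite /ocount -sum_nat_const; apply: eq_bigr => A.
rewrite inE => /andP[/imsetP[t _ ->]]; rewrite okey_porbit => /eqP tc.
rewrite -tc /= -sum1_card; apply: eq_bigl => u.
rewrite inE eq_porbit_mem; case: (boolP (u \in _)) => [ut|]; rewrite ?andbF //.
by rewrite (ckey_porbit ut) tc eqxx.
Qed.

Lemma sum_pcount (K : {fset nat * {set gT}}) :
  (forall t, ckey s g t \in K) -> \sum_(c <- K) pcount s g c = #|T|.
Proof.
move=> inK; rewrite -sum1_card.
under eq_bigr => c _ do rewrite /pcount -sum1dep_card big_mkcond.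
rewrite exchange_big; apply: eq_bigr => t _ /=.
rewrite (big_fsetD1 _ (inK t)) /= eqxx big1_fset ?addn0 // => c.
by rewrite !inE eq_sym => /andP[/negPf ->].
Qed.

(** A point of the cycle of t, depending only on that cycle. *)
Definition orep t := odflt t [pick u in porbit s t].

Lemma orep_mem t : orep t \in porbit s t.
Proof. by rewrite /orep; case: pickP => // /(_ t); rewrite porbit_id. Qed.

Lemma eq_orep t u : porbit s t = porbit s u -> orep t = orep u.
Proof.
by rewrite /orep => <-; case: pickP => // /(_ t); rewrite porbit_id.
Qed.

End Keys.

(** Two finite families with equally many members of each colour can be matched
    respecting colours. *)
Lemma colour_matching (A B : finType) (K : eqType) (f : A -> K) (g : B -> K)
    (P : {set A}) (Q : {set B}) (b0 : B) :
    (forall c, #|[set a in P | f a == c]| = #|[set b in Q | g b == c]|) ->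
  exists b : A -> B,
    (forall a, a \in P -> b a \in Q /\ g (b a) = f a) /\ {in P &, injective b}.
Proof.
move=> eqc.
pose S c := enum [set a in P | f a == c]; pose S' c := enum [set b in Q | g b == c].
have memS c a : (a \in S c) = (a \in P) && (f a == c) by rewrite [LHS]mem_enum inE.
have memS' c b : (b \in S' c) = (b \in Q) && (g b == c) by rewrite [LHS]mem_enum inE.
have szS c : size (S c) = size (S' c) by rewrite -!cardE.
pose b a := nth b0 (S' (f a)) (index a (S (f a))).
have bS a : a \in P -> index a (S (f a)) < size (S' (f a)).
  by move=> aP; rewrite -szS index_mem memS aP /=.
have bP a : a \in P -> b a \in Q /\ g (b a) = f a.
  by move=> /bS /(mem_nth b0); rewrite memS' => /andP[? /eqP].
exists b; split=> // a a' aP a'P eqb.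
have ff : f a = f a' by case: (bP a aP) => _ <-; rewrite eqb; case: (bP a' a'P).
move/eqP: eqb; rewrite /b -ff nth_uniq ?enum_uniq ?bS //; last by rewrite ff bS.
move/eqP => eq_ind.
have aS : a \in S (f a) by rewrite memS aP /=.
by rewrite -[a](nth_index a aS) eq_ind nth_index // memS a'P ff /=.
Qed.

Section Isomorphism.
Variables (gT : finGroupType) (T T' : finType).
Variables (s : {perm T}) (g : T -> gT) (s' : {perm T'}) (g' : T' -> gT).

(** Equal numbers of cycles of each key make two labelled permutations
    isomorphic: match the cycles, then a base point of each cycle, and spread
    along the cycle. *)
Lemma labelled_perm_iso :
    (forall c, ocount s g c = ocount s' g' c) ->
  exists tau : T -> T', exists k : T -> gT, injective tau /\
    forall t, tau (s t) = s' (tau t) /\ k (s t) * g t = g' (tau t) * k t.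
Proof.
move=> /(colour_matching finset.set0) [b [bP b_inj]].
have orbP t : porbit s t \in porbits s by apply: imset_f.
(* A base point (ph t).1 for the cycle matched with that of t, and an element
   (ph t).2 relating the two cycle products. *)
have /boolp.choice[ph phP] t : exists p : T' * gT,
    [/\ porbit s' p.1 = b (porbit s t),
        #|porbit s' p.1| = #|porbit s t| &
        cocyc s' g' #|porbit s t| p.1 * p.2
          = p.2 * cocyc s g #|porbit s t| t].
  have [] := bP _ (orbP t).
  case/imsetP=> t' _ ->; rewrite !okey_porbit => -[Lt' clt'].
  have /imsetP[h _ hE] : cocyc s g #|porbit s t| t \in
      cocyc s' g' #|porbit s' t'| t' ^: [set: gT].
    by rewrite clt' class_refl.
  by exists (t', h); split=> //=; rewrite -Lt' [in RHS]Lt' hE -conjgC.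
have /boolp.choice[m mP] t : exists m, t = iter m s (orep s t).
  have := orep_mem s t.
  by rewrite porbit_sym => /porbitP[i it]; exists i; rewrite -permX.
pose r := orep s; pose c t := (ph (r t)).1; pose h t := (ph (r t)).2.
(* The values of tau and k at t do not depend on the number of steps chosen to
   reach t from the base point of its cycle. *)
pose tau t := iter (m t) s' (c t).
pose k t := cocyc s' g' (m t) (c t) * h t * (cocyc s g (m t) (r t))^-1.
have tauE q t : iter q s (r t) = t -> tau t = iter q s' (c t).
  have [_ Lr _] := phP (r t).
  rewrite {2}[t]mP => /eq_iter_porbit qm.
  by rewrite /tau iter_porbitD [RHS]iter_porbitD Lr qm.
have kE q t : iter q s (r t) = t ->
    k t = cocyc s' g' q (c t) * h t * (cocyc s g q (r t))^-1.
  have [_ Lr hr] := phP (r t); rewrite -/(c t) -/(h t) in Lr hr.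
  have hX e : cocyc s' g' #|porbit s (r t)| (c t) ^+ e * h t
      = h t * cocyc s g #|porbit s (r t)| (r t) ^+ e.
    by elim: e => [|e IHe]; rewrite ?mulg1 ?mul1g // !expgSr -mulgA hr !mulgA IHe.
  have kq p : cocyc s' g' p (c t) * h t * (cocyc s g p (r t))^-1 =
      cocyc s' g' (p %% #|porbit s (r t)|) (c t) * h t
        * (cocyc s g (p %% #|porbit s (r t)|) (r t))^-1.
    rewrite cocyc_porbitD (cocyc_porbitD s g (r t)) Lr invMg !mulgA; congr (_ * _).
    by rewrite -[X in X * _]mulgA hX mulgA mulgK.
  rewrite {2}[t]mP => /eq_iter_porbit qm.
  by rewrite /k kq [RHS]kq qm.
have rs t : r (s t) = r t by apply: eq_orep; apply: porbit1.
have cs t : c (s t) = c t by rewrite /c rs.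
have hs t : h (s t) = h t by rewrite /h rs.
have sm t : iter (m t).+1 s (r (s t)) = s t by rewrite rs /= -mP.
exists tau, k; split=> [t u eq_tu|t]; last first.
  split; first by rewrite (tauE _ _ (sm t)) cs.
  by rewrite (kE _ _ (sm t)) cs hs rs !cocycS -mP invMg !mulgA mulgKV.
have porbR v : porbit s (r v) = porbit s v.
  by apply/eqP; rewrite eq_porbit_mem orep_mem.
have porbtau v : porbit s' (tau v) = b (porbit s v).
  by rewrite /tau -permX porbit_perm; have [-> _ _] := phP (r v); rewrite porbR.
have /eq_orep ru : porbit s t = porbit s u.
  by apply: b_inj; rewrite ?orbP // -!porbtau eq_tu.
rewrite -/(r t) -/(r u) in ru.
have [_ Lr _] := phP (r u).
move: eq_tu; rewrite /tau /c ru => /eq_iter_porbit; rewrite Lr => mm.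
by rewrite [t]mP [u]mP -/(r t) ru (iter_porbitD s (r u)) mm -iter_porbitD.
Qed.

End Isomorphism.

(** * Modified types *)

Lemma intpart_eq (p q : intpart) :
  (forall r, 0 < r -> count_mem r p = count_mem r q) -> p = q.
Proof.
move=> pq; have /andP[p_sorted p0] := partsP p.
have /andP[q_sorted q0] := partsP q.
apply: val_inj => /=; apply: (@sorted_eq _ geq) => //.
- by move=> i j k /= ji ik; apply: leq_trans ik ji.
- by move=> i j; rewrite andbC => /anti_leq.
apply/allP => -[|r] _; last exact/eqP/pq.
by rewrite /= (count_memPn p0) (count_memPn q0).
Qed.

Section ModifiedType.
Variable gT : finGroupType.
Implicit Types (c : conjcl gT) (nu : ptypes gT).
Local Notation c0 := (conjcl1 gT).

(** Elements of Γ_n seen as labelled permutations. *)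
Definition wkey n (x : wreath gT n) (i : 'I_n) := ckey (wperm x) (wcoord x) i.
Definition wcount n (x : wreath gT n) := pcount (wperm x) (wcoord x).

Lemma mem_conjcl c a : (a \in val c) = (a ^: [set: gT] == val c).
Proof.
have /imsetP[b _ ->] := valP c.
by apply/class_eqP/eqP.
Qed.

Lemma count_ctype_ocount n (x : wreath gT n) c r : 0 < r ->
  count_mem r (ctype x c) = ocount (wperm x) (wcoord x) (r, val c).
Proof.
move=> r_gt0; rewrite count_ctype //; apply: eq_card => A; rewrite !inE.
apply: andb_id2l => /imsetP[i _ ->{A}].
rewrite okey_porbit xpair_eqE andbC; congr (_ && _).
apply/existsP/idP => [[j /andP[ji]]|ic]; last first.
  by exists i; rewrite porbit_id mem_conjcl; apply: ic.
by have [_ <-] := ckey_porbit (wcoord x) ji; rewrite mem_conjcl.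
Qed.

Lemma count_mtype n (x : wreath gT n) c r : 0 < r - (c == c0) ->
  count_mem (r - (c == c0)) (mtype x c)
    = ocount (wperm x) (wcoord x) (r, val c).
Proof.
rewrite [mtype x c]ffunE; case: (c =P c0) => [->|_] r_gt0; last first.
  by rewrite subn0 in r_gt0 *; apply: count_ctype_ocount.
case: r r_gt0 => // -[//|r] _.
rewrite -count_ctype_ocount // subn1 count_mkpart // count_map.
by apply: eq_count => -[|j] /=; rewrite ?eqSS.
Qed.

(** The modified type is read off the numbers of points of each key other than
    [key1]. In the class of 1 a cycle of length r gives a part r - 1, whence the
    truncated subtraction of a boolean. *)
Lemma mtypeP n (x : wreath gT n) nu :
  mtype x = nu <-> forall c r, 0 < r - (c == c0) ->
    wcount x (r, val c) = (count_mem (r - (c == c0)) (nu c) * r)%N.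
Proof.
split=> [<- c r r_gt0|cnt].
  by rewrite count_mtype // /wcount pcount_ocount.
apply/ffunP => c; apply: intpart_eq => r r_gt0.
have := cnt c (r + (c == c0))%N; rewrite addnK => /(_ r_gt0) /eqP.
rewrite /wcount pcount_ocount /= eqn_pmul2r ?addn_gt0 ?r_gt0 // => /eqP <-.
by rewrite -count_mtype ?addnK.
Qed.

Lemma key1E c r : ((r, val c) == key1 gT) = (r - (c == c0) == 0) && (r != 0).
Proof.
rewrite xpair_eqE -[[set 1]]/(val c0) (inj_eq val_inj).
by case: (c == c0); case: r => [|[|r]].
Qed.

(** Only the keys other than that of a trivial point matter, so m and n may
    differ. *)
Lemma eq_mtype m n (x : wreath gT m) (y : wreath gT n) :
  (forall k, k != key1 gT -> wcount x k = wcount y k) -> mtype x = mtype y.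
Proof.
move=> eq_xy; apply/mtypeP => c r r_gt0.
have [/(_ erefl) /(_ _ _ r_gt0) <- _] := mtypeP y (mtype y).
by apply: eq_xy; rewrite key1E -leqn0 leqNgt r_gt0.
Qed.

Lemma wkey_conjcl n (x : wreath gT n) i :
  exists c r, 0 < r /\ wkey x i = (r, val c).
Proof.
have cP : cycle_product x i ^: [set: gT] \in classes [set: gT].
  by apply: imset_f; rewrite inE.
exists (@exist _ (fun A => A \in classes [set: gT]) _ cP), #|porbit (wperm x) i|; split=> //.
by rewrite lt0n card_porbit_neq0.
Qed.

(** Same size and same modified type force the same number of trivial points,
    hence the same number of cycles of every key. *)
Lemma eq_mtype_ocount n (x y : wreath gT n) : mtype x = mtype y ->
  forall k, ocount (wperm x) (wcoord x) k = ocount (wperm y) (wcoord y) k.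
Proof.
move=> xy.
have occurs (w : wreath gT n) i : wkey w i != key1 gT ->
    wcount x (wkey w i) = wcount y (wkey w i).
  have [c [r [r_gt0 ->]]] := wkey_conjcl w i.
  rewrite key1E negb_and negbK -lt0n (gtn_eqF r_gt0) orbF => rc_gt0.
  have [/(_ erefl) -> // _] := mtypeP y (mtype y).
  by have [/(_ xy) -> // _] := mtypeP x (mtype y).
have N1 k : k != key1 gT -> wcount x k = wcount y k.
  move=> kN1.
  have [/existsP[i /eqP ik]|no_x] := boolP [exists i, wkey x i == k].
    by rewrite -ik occurs // ik.
  have [/existsP[i /eqP ik]|no_y] := boolP [exists i, wkey y i == k].
    by rewrite -ik occurs // ik.
  rewrite /wcount /pcount !eq_card0 // => i; rewrite !inE; apply/negP => ik.
    by case/existsP: no_y; exists i.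
  by case/existsP: no_x; exists i.
have eqw k : wcount x k = wcount y k.
  have [->|/N1 //] := eqVneq k (key1 gT).
  (* The counts of all keys add up to n on both sides. *)
  pose K := ([fset wkey x i | i in 'I_n] `|` [fset wkey y i | i in 'I_n]
              `|` [fset key1 gT])%fset.
  have : \sum_(k <- K) wcount x k = \sum_(k <- K) wcount y k.
    rewrite !sum_pcount // => i; rewrite !inE; apply/orP; left; apply/orP.
      by right; apply/imfsetP; exists i.
    by left; apply/imfsetP; exists i.
  have K1 : key1 gT \in K by rewrite !inE eqxx orbT.
  rewrite !(big_fsetD1 _ K1) /= => /eqP.
  rewrite [X in _ + X]big_seq [X in _ == _ + X]big_seq.
  rewrite (eq_bigr (wcount y)) ?eqn_add2r => [/eqP //|k'].
  by rewrite !inE => /andP[/N1].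
move=> [r C].
have [->|r_gt0] := posnP r; last first.
  have := eqw (r, C); rewrite /wcount !pcount_ocount /= => /eqP.
  by rewrite eqn_pmul2r // => /eqP.
rewrite /ocount !eq_card0 // => A; rewrite !inE; apply/negP.
all: case/andP=> /imsetP[i _ ->]; rewrite okey_porbit xpair_eqE.
all: by rewrite (negPf (card_porbit_neq0 _ _)).
Qed.

End ModifiedType.

(** * Change of index set *)

Section Push.
Variable gT : finGroupType.

Lemma wreathP n (x y : wreath gT n) :
  wcoord x =1 wcoord y -> wperm x =1 wperm y -> x = y.
Proof. by case: x y => [g s] [h t] /= /ffunP -> /permP ->. Qed.

(** The indices which x does not fix with trivial label. *)
Definition wsupp n (x : wreath gT n) : {set 'I_n} :=
  [set i | (wperm x i != i) || (wcoord x i != 1)].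

Lemma wsuppPn n (x : wreath gT n) i :
  i \notin wsupp x -> wperm x i = i /\ wcoord x i = 1.
Proof. by rewrite inE negb_or !negbK => /andP[/eqP ? /eqP]. Qed.

Lemma wcoordM n (x y : wreath gT n) i :
  wcoord (x * y) i = wcoord x i * wcoord y ((wperm x)^-1 i).
Proof. by rewrite ffunE. Qed.

Lemma wpermM n (x y : wreath gT n) i : wperm (x * y) i = wperm x (wperm y i).
Proof. exact: permM. Qed.

Variables (m n : nat) (phi : 'I_m -> 'I_n).
Hypothesis phi_inj : injective phi.
Implicit Types (x y : wreath gT m) (z : wreath gT n).

Definition push_fun (s : 'S_m) (j : 'I_n) : 'I_n :=
  if [pick i | phi i == j] is Some i then phi (s i) else j.

Lemma push_funE s i : push_fun s (phi i) = phi (s i).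
Proof.
rewrite /push_fun; case: pickP => [i' /eqP/phi_inj -> //|/(_ i)].
by rewrite eqxx.
Qed.

Lemma push_fun_out s j : j \notin codom phi -> push_fun s j = j.
Proof.
by rewrite /push_fun; case: pickP => // i /eqP <-; rewrite codom_f.
Qed.

Lemma push_fun_inj s : injective (push_fun s).
Proof.
apply: (can_inj (g := push_fun s^-1)) => j.
have [/codomP[i ->]|jN] := boolP (j \in codom phi).
  by rewrite !push_funE permK.
by rewrite !push_fun_out.
Qed.

(** The transport of an element of Γ_m along an injection of the index sets;
    it acts trivially outside the image of the injection. *)
Definition push x : wreath gT n :=
  Wreath [ffun j => if [pick i | phi i == j] is Some i then wcoord x i else 1]
         (perm (@push_fun_inj (wperm x))).

Lemma push_perm x i : wperm (push x) (phi i) = phi (wperm x i).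
Proof. by rewrite permE push_funE. Qed.

Lemma push_coord x i : wcoord (push x) (phi i) = wcoord x i.
Proof.
rewrite ffunE; case: pickP => [i' /eqP/phi_inj -> //|/(_ i)].
by rewrite eqxx.
Qed.

Lemma push_out x j : j \notin codom phi ->
  wperm (push x) j = j /\ wcoord (push x) j = 1.
Proof.
move=> jN; rewrite permE push_fun_out // ffunE; split=> //.
by case: pickP jN => // i /eqP <-; rewrite codom_f.
Qed.

Lemma pushE x z :
    (forall i, wperm z (phi i) = phi (wperm x i)) ->
    (forall i, wcoord z (phi i) = wcoord x i) ->
    (forall j, j \notin codom phi -> wperm z j = j /\ wcoord z j = 1) ->
  push x = z.
Proof.
move=> zs zg z1; apply: wreathP => j.
  have [/codomP[i ->]|jN] := boolP (j \in codom phi).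
    by rewrite push_coord zg.
  by have [_ ->] := push_out x jN; have [_ ->] := z1 _ jN.
have [/codomP[i ->]|jN] := boolP (j \in codom phi).
  by rewrite push_perm zs.
by have [-> _] := push_out x jN; have [-> _] := z1 _ jN.
Qed.

Lemma pushM x y : push (x * y) = push x * push y.
Proof.
have Vfix (s : 'S_n) j : s j = j -> s^-1 j = j by move=> {1}<-; rewrite permK.
apply: pushE => [i|i|j jN]; first by rewrite !wpermM !push_perm.
  rewrite !wcoordM push_coord; congr (_ * _).
  have -> : (wperm (push x))^-1 (phi i) = phi ((wperm x)^-1 i).
    by rewrite -{1}[i](permKV (wperm x)) -push_perm permK.
  by rewrite push_coord.
have [[sx gx] [sy gy]] := (push_out x jN, push_out y jN).
by rewrite wpermM sy sx wcoordM gx Vfix // gy mulg1.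
Qed.

Lemma pushV x : push x^-1 = (push x)^-1.
Proof.
apply: (mulgI (push x)); rewrite mulgV -pushM mulgV.
apply: pushE => [i|i|j _] /=; rewrite ?perm1 ?ffunE //.
Qed.

Lemma push_inj : injective push.
Proof.
move=> x y xy; apply: wreathP => i.
  by rewrite -[LHS]push_coord xy push_coord.
by apply: phi_inj; rewrite -!push_perm xy.
Qed.

Lemma wsupp_push x : wsupp (push x) = phi @: wsupp x.
Proof.
apply/setP => j; have [/codomP[i ->]|jN] := boolP (j \in codom phi).
  by rewrite mem_imset // !inE push_perm push_coord (inj_eq phi_inj).
have [sj gj] := push_out x jN; rewrite inE sj gj !eqxx; apply/esym/negbTE.
by apply: contra jN => /imsetP[i _ ->]; rewrite codom_f.
Qed.

Lemma push_surj z : {subset wsupp z <= codom phi} -> exists x, push x = z.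
Proof.
move=> zphi.
have z1 j : j \notin codom phi -> wperm z j = j /\ wcoord z j = 1.
  by move=> jN; apply: wsuppPn; apply: contra jN => /zphi.
have zs i : wperm z (phi i) \in codom phi.
  apply/negPn/negP => jN; have [/perm_inj zi _] := z1 _ jN.
  by rewrite zi codom_f in jN.
pose s i := iinv (zs i).
have sE i : phi (s i) = wperm z (phi i) by rewrite /s f_iinv.
have s_inj : injective s.
  by move=> i i' /(congr1 phi); rewrite !sE => /perm_inj/phi_inj.
exists (Wreath [ffun i => wcoord z (phi i)] (perm s_inj)).
by apply: pushE => // i; rewrite ?ffunE //= permE sE.
Qed.

Lemma mtype_push x : mtype (push x) = mtype x.
Proof.
apply: eq_mtype => k kN1; apply: (@pcount_transport _ _ _ _ _ _ _ phi (fun=> 1)) => //.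
- by move=> i; rewrite push_perm.
- by move=> i; rewrite push_coord mulg1 mul1g.
- exact: push_out.
Qed.

End Push.

Lemma push_comp (gT : finGroupType) l m n (phi : 'I_l -> 'I_m)
    (psi : 'I_m -> 'I_n) (chi : 'I_l -> 'I_n) (phi_inj : injective phi)
    (psi_inj : injective psi) (chi_inj : injective chi) (x : wreath gT l) :
  psi \o phi =1 chi -> push psi_inj (push phi_inj x) = push chi_inj x.
Proof.
move=> comp; have compE i : chi i = psi (phi i) by rewrite -comp.
apply/esym/pushE => [i|i|j jN].
- by rewrite !compE !push_perm.
- by rewrite !compE !push_coord.
have [/codomP[i ji]|/push_out //] := boolP (j \in codom psi).
rewrite ji push_perm push_coord.
have iN : i \notin codom phi.
  by apply: contra jN => /codomP[i' ii']; rewrite ji ii' -compE codom_f.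
by have [-> ->] := push_out phi_inj x iN.
Qed.

(** * Conjugacy *)

Section Conjugacy.
Variable gT : finGroupType.

(** Conjugate elements of Γ_n are isomorphic as labelled permutations, by
    definition of the product of Γ_n. *)
Lemma mtype_conj n (x z : wreath gT n) : mtype (x ^ z) = mtype x.
Proof.
set x' := x ^ z; have eq_zx : z * x' = x * z by rewrite -conjgC.
have sE j : wperm z (wperm x' j) = wperm x (wperm z j).
  by have /(congr1 (fun w => wperm w j)) := eq_zx; rewrite /= !permM.
apply: esym; apply: eq_mtype => k kN1.
(* At the index wperm z j, the equation z * x' = x * z says exactly that h
   intertwines the labels of x' and x. *)
pose h j := wcoord z (wperm z ((wperm x')^-1 j)).
apply: (@pcount_transport _ _ _ _ _ _ _ (wperm z) h) => //.
- exact: perm_inj.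
- move=> j; rewrite /h permK.
  have /(congr1 (fun w => wcoord w (wperm z j))) := eq_zx.
  rewrite /= !ffunE permK => ->; congr (_ * wcoord z _).
  by rewrite -{1}[j](permKV (wperm x')) sE permK.
by move=> j; rewrite -{1}[j](permKV (wperm z)) codom_f.
Qed.

Lemma eq_mtype_conj n (x y : wreath gT n) :
  mtype x = mtype y -> exists z, x ^ z = y.
Proof.
move=> /esym/eq_mtype_ocount/labelled_perm_iso[tau [k [tau_inj tk]]].
pose p := perm tau_inj.
have pE j : p j = tau j by rewrite permE.
exists (Wreath [ffun i => k (wperm y (p^-1 i))] p).
apply: (mulgI (Wreath [ffun i => k (wperm y (p^-1 i))] p)).
rewrite -conjgC; apply: wreathP => i /=; last first.
  by rewrite !permM !pE; have [-> _] := tk i.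
rewrite !ffunE -[i](permKV p); move: (p^-1 i) => {i}j.
rewrite permK pE; have [sj ->] := tk j; congr (_ * k _).
have -> : (wperm x)^-1 (tau j) = p ((wperm y)^-1 j).
  have [sj' _] := tk ((wperm y)^-1 j); rewrite permKV in sj'.
  by rewrite pE sj' permK.
by rewrite permK permKV.
Qed.

Lemma embed_push m n (phi : 'I_m -> 'I_n) (phi_inj : injective phi) x :
  (forall i, phi i = i :> nat) -> embed (push phi_inj x) = embed x :> ginf gT.
Proof.
move=> phiE; apply: ginfP => j /=; rewrite /ext_coord /ext_perm.
all: have [jm|mj] := ltnP j m.
- rewrite -[j]/(val (Ordinal jm)) valK -[X in insub X]phiE.
  by rewrite valK push_coord.
- rewrite [in RHS]insubN -?leqNgt //; case: insubP => // i _ ij.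
  have iN : i \notin codom phi.
    by apply/codomP => -[i' ii']; move: (ltn_ord i'); rewrite -phiE -ii' [X in X < _]ij ltnNge mj.
  by have [_ ->] := push_out phi_inj x iN.
- rewrite -[j]/(val (Ordinal jm)) valK -[X in insub X]phiE.
  by rewrite valK push_perm /= phiE.
rewrite [in RHS]insubN -?leqNgt //; case: insubP => // i _ ij.
have iN : i \notin codom phi.
  by apply/codomP => -[i' ii']; move: (ltn_ord i'); rewrite -phiE -ii' [X in X < _]ij ltnNge mj.
by have [-> _] := push_out phi_inj x iN.
Qed.

End Conjugacy.

Section ConjugacyInfty.
Variable gT : finGroupType.
Implicit Types (nu : ptypes gT) (x y z : ginf gT).

Lemma embedV n (x : wreath gT n) : embed x^-1 = (embed x)^-1.
Proof.
apply: (mulgI (embed x)); rewrite mulgV -embedM mulgV.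
apply: ginfP => j /=; rewrite /ext_coord /ext_perm; case: insubP => // i _ ij.
  by rewrite ffunE.
by rewrite perm1.
Qed.

Lemma embedJ n (x z : wreath gT n) : embed (x ^ z) = embed x ^ embed z.
Proof. by rewrite !conjgE !embedM embedV. Qed.

Lemma embed_widen m n (le_mn : m <= n) (x : wreath gT m) :
  exists2 y : wreath gT n, embed y = embed x & mtype y = mtype x.
Proof.
have inj : injective (widen_ord le_mn) by move=> i j [] /val_inj.
by exists (push inj x); [apply: embed_push | apply: mtype_push].
Qed.

(** Any two elements of Γ_∞ lie in Γ_(N + m) for some m. *)
Lemma embed_pair N x y : exists m (x' y' : wreath gT (N + m)),
  embed x' = x /\ embed y' = y.
Proof.
have [n [x' <-]] := embed_union x; have [n' [y' <-]] := embed_union y.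
have nN : n <= N + (n + n') by rewrite addnCA leq_addr.
have n'N : n' <= N + (n + n') by rewrite addnA leq_addl.
have [[x'' <- _] [y'' <- _]] := (embed_widen nN x', embed_widen n'N y').
by exists (n + n')%N, x'', y''.
Qed.

Lemma Kinf_embed nu n (x : wreath gT n) : Kinf nu (embed x) <-> mtype x = nu.
Proof.
split=> [[m [y [yx <-]]]|xnu]; last by exists n, x.
have [x' x'x <-] := embed_widen (leq_maxl n m) x.
have [y' y'y <-] := embed_widen (leq_maxr n m) y.
by congr mtype; apply: embed_inj; rewrite x'x -yx y'y.
Qed.

Lemma Kinf_conj nu x z : Kinf nu x -> Kinf nu (x ^ z).
Proof.
have [m [x' [z' [<- <-]]]] := embed_pair 0 x z.
by rewrite -embedJ !Kinf_embed mtype_conj.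
Qed.

Lemma Kinf_conjP nu x y : Kinf nu x -> Kinf nu y -> exists z, x ^ z = y.
Proof.
have [m [x' [y' [<- <-]]]] := embed_pair 0 x y.
rewrite !Kinf_embed => <- /esym/eq_mtype_conj[z <-].
by exists (embed z); rewrite embedJ.
Qed.

End ConjugacyInfty.

(** * Elements of given modified type *)

Section StandardCycle.
Variables (gT : finGroupType) (n : nat) (a : gT).
(** The cycle 0 -> 1 -> ... -> n -> 0, with label a at 0 and 1 elsewhere. *)
Let s : 'S_n.+1 := perm (@ordS_inj n.+1).
Let g (i : 'I_n.+1) : gT := if i == 0%N :> nat then a else 1.

Lemma iter_ordS q : iter q s ord0 = q %% n.+1 :> nat.
Proof.
elim: q => [|q IHq]; first by rewrite mod0n.
by rewrite /= permE /= IHq -[X in X %% _]addn1 modnDml addn1.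
Qed.

Lemma ckey_standard_cycle i : ckey s g i = (n.+1, a ^: [set: gT]).
Proof.
have orb : porbit s ord0 = [set: 'I_n.+1].
  apply/setP => j; rewrite inE; apply/porbitP; exists j; apply: val_inj.
  by rewrite permX /= iter_ordS modn_small.
rewrite (@ckey_porbit _ _ s g ord0) ?orb ?inE // /ckey orb cardsT card_ord.
suff co q : q <= n -> cocyc s g q.+1 ord0 = a by rewrite co.
elim: q => [_|q IHq qn]; first by rewrite cocycS cocyc0 mulg1.
by rewrite cocycS (IHq (ltnW qn)) /g iter_ordS modn_small // mul1g.
Qed.

End StandardCycle.

(** A labelled permutation of a set with n points, carried over to {0..n-1}. *)
Lemma labelled_perm_wreath (gT : finGroupType) n (T : finType) (s : {perm T})
    (g : T -> gT) : #|T| = n ->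
  exists (x : wreath gT n) (tau : 'I_n -> T),
    (forall i, wkey x i = ckey s g (tau i)) /\ 
    (forall k, wcount x k = pcount s g k).
Proof.
move=> Tn; subst n.
have r_inj : injective (fun i : 'I_#|T| => enum_rank (s (enum_val i))).
  by move=> i j /enum_rank_inj/perm_inj/enum_val_inj.
pose x := Wreath [ffun i => g (enum_val i)] (perm r_inj).
have key i : wkey x i = ckey s g (enum_val i).
  apply/esym; apply: (@ckey_transport _ _ _ _ _ _ _ enum_val (fun=> 1)).
  - exact: enum_val_inj.
  - by move=> j; rewrite permE enum_rankK.
  - by move=> j; rewrite ffunE mulg1 mul1g.
exists x, enum_val; split=> // k.
rewrite /wcount /pcount -[RHS](card_imset _ (@enum_rank_inj T)); apply: eq_card => i.
rewrite inE [ckey _ _ i]key; apply/idP/imsetP => [ik|[t]].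
  by exists (enum_val i); rewrite ?inE // enum_valK.
by rewrite inE => tk ->; rewrite enum_rankK.
Qed.

(** ‖ν‖ + ℓ(ν(c⁰)), the size of the support of the elements of K_ν. *)
Definition pweight (gT : finGroupType) (nu : ptypes gT) : nat :=
  pnorm nu + size (nu (conjcl1 gT)).

Section Existence.
Variables (gT : finGroupType) (nu : ptypes gT).
Local Notation c0 := (conjcl1 gT).

(** The cycles are indexed by the parts of all the partitions; L is the length
    of the cycle, one more than the part in the class of 1. *)
Let I : finType := {c : conjcl gT & 'I_(size (nu c))}.
Let L (i : I) : nat := nth 0 (nu (tag i)) (tagged i) + (tag i == c0).

Let L_gt (i : I) : 0 < L i - (tag i == c0).
Proof.
rewrite /L addnK lt0n; have /andP[_ /memPn] := partsP (nu (tag i)).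
by apply; apply: mem_nth.
Qed.

Let T : finType := {i : I & 'I_(L i)}.

Let sum_I (F : conjcl gT -> nat -> nat) :
  \sum_(i : I) F (tag i) (nth 0 (nu (tag i)) (tagged i))
    = \sum_c \sum_(r <- nu c) F c r.
Proof.
under [RHS]eq_bigr => c _ do rewrite (big_nth 0) big_mkord.
by rewrite sig_big_dep.
Qed.

Let card_T : #|T| = pweight nu.
Proof.
rewrite card_tagged sumnE big_map big_enum /=.
under eq_bigr => i _ do rewrite card_ord.
rewrite (sum_I (fun c r => r + (c == c0))) /pweight /pnorm.
under eq_bigr => c _ do rewrite big_split /= -sumnE big_const_seq count_predT iter_addn_0.
rewrite big_split /=; congr addn.
rewrite (bigD1 c0) //= eqxx mul1n big1 ?addn0 // => c /negPf ->.
by rewrite mul0n.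
Qed.

(** Every modified type ν is attained in Γ_n for n = ‖ν‖ + ℓ(ν(c⁰)), by an
    element without trivial points. *)
Lemma mtype_exists : exists x : wreath gT (pweight nu),
  mtype x = nu /\ wsupp x = [set: 'I_(pweight nu)].
Proof.
pose sf (t : T) : T := Tagged (fun i => 'I_(L i)) (ordS (tagged t)).
have sf_inj : injective sf.
  apply: (@can_inj _ _ _ (fun t => Tagged (fun i => 'I_(L i)) (ord_pred (tagged t)))).
  by case=> i m; rewrite /sf /= ordSK.
pose g (t : T) : gT := if tagged t == 0 :> nat then repr (val (tag (tag t))) else 1.
have key (t : T) : ckey (perm sf_inj) g t = (L (tag t), val (tag (tag t))).
  case: t => i m /=; pose tau (m : 'I_(L i)) : T := Tagged (fun i => 'I_(L i)) m.
  have L_gt0 : 0 < L i by apply: leq_trans (L_gt i) (leq_subr _ _).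
  pose a := repr (val (tag i)).
  rewrite -[existT _ _ _]/(tau m).
  rewrite (@ckey_transport _ _ _ (perm (@ordS_inj (L i)))
    (fun m => if m == 0 :> nat then a else 1) _ _ tau (fun=> 1)).
  - have tagC : a ^: [set: gT] = val (tag i).
      have /imsetP[b _ ib] := valP (tag i); rewrite /a ib.
      by apply/class_eqP; rewrite (mem_repr b) ?class_refl.
    move: m; clear -L_gt0 tagC; rewrite -tagC; case: (L i) L_gt0 => // l _ m.
    exact: ckey_standard_cycle.
  - by move=> m' m'' /eqP; rewrite eq_Tagged => /eqP.
  - by move=> m'; rewrite !permE.
  - by move=> m'; rewrite mulg1 mul1g.
have [x [tau [xkey xcount]]] := labelled_perm_wreath (perm sf_inj) g card_T.
exists x; split; last first.
  apply/setP => j; rewrite [RHS]inE; apply/negPn/negP => /wsuppPn[xj gj].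
  have := xkey j; rewrite key [LHS]ckey_fixed // => /esym/eqP.
  by rewrite key1E -leqn0 leqNgt L_gt.
apply/mtypeP => c r r_gt0; rewrite xcount /pcount -sum1dep_card.
rewrite big_mkcond /=.
under eq_bigr => t _ do rewrite key.
have -> : \sum_(t : T) (if (L (tag t), val (tag (tag t))) == (r, val c) then 1 else 0)
    = \sum_(i : I) (if (L i == r) && (tag i == c) then r else 0).
  rewrite -(@sig_big_dep nat 0%N addn I (fun i => 'I_(L i)) xpredT (fun _ => xpredT)
     (fun i _ => if (L i, val (tag i)) == (r, val c) then 1%N else 0%N)).
  apply: eq_bigr => i _; rewrite xpair_eqE (inj_eq val_inj).
  case: eqP => [<-|_]; case: eqP => _ /=; rewrite ?big_const_ord ?iter_addn_0 //.
  by rewrite mul1n.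
rewrite (sum_I (fun c' r' => if (r' + (c' == c0) == r) && (c' == c) then r else 0)).
rewrite (bigD1 c) //= [X in _ + X]big1 => [|c' /negPf c'c]; last first.
  by rewrite big1 // => r' _; rewrite c'c andbF.
rewrite addn0 eqxx -big_mkcond /= big_const_seq iter_addn_0 mulnC; congr (_ * _)%N.
apply: eq_count => r' /=; rewrite andbT -[RHS](eqn_add2r (c == c0)) subnK //.
by rewrite ltnW // -subn_gt0.
Qed.

End Existence.

(** * Structure constants as numbers of factorizations *)

Section Factorizations.
Variables (gT : finGroupType) (n : nat).
Implicit Types (lam mu nu : ptypes gT) (x y z : wreath gT n).

(** The first factors of the factorizations of z in Γ_n with factors of modified
    types lam and mu. *)
Definition factors lam mu z : {set wreath gT n} :=
  [set x | (mtype x == lam) && (mtype (x^-1 * z) == mu)].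

Lemma card_factors_conj lam mu z w :
  #|factors lam mu (z ^ w)| = #|factors lam mu z|.
Proof.
rewrite -[RHS](card_imset _ (conjg_inj w)); apply: eq_card => x.
apply/idP/imsetP => [xz|[y yz ->]].
  exists (x ^ w^-1); last by rewrite conjgKV.
  by move: xz; rewrite !inE -(mtype_conj _ w^-1) -(mtype_conj (_^-1 * _) w^-1)
    conjMg conjgK conjVg.
by move: yz; rewrite !inE -conjVg -conjMg !mtype_conj.
Qed.

Local Open Scope ring_scope.

Lemma KsumE lam x : Ksum n lam x = (mtype x == lam)%:R.
Proof.
rewrite /Ksum sum_ffunE big_mkcond /= (bigD1 x) //= big1 ?addr0 => [|y yx].
  case: asboolP => [/Kinf_embed -> |xN]; first by rewrite ffunE !eqxx.
  by case: eqP => // xlam; case: xN; apply/Kinf_embed.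
by case: ifP => //; rewrite ffunE eq_sym (negPf yx).
Qed.

Lemma gconv_Ksum lam mu z :
  gconv (Ksum n lam) (Ksum n mu) z = #|factors lam mu z|%:R.
Proof.
rewrite ffunE (reindex_onto (fun x => (x, x^-1 * z)%g) fst) /=; last first.
  by case=> x y /= /eqP <-; rewrite mulKg.
under eq_bigl => x do rewrite mulKVg !eqxx.
rewrite -sum1_card natr_sum [RHS]big_mkcond /=; apply: eq_bigr => x _.
by rewrite !KsumE inE; case: (_ == _); case: (_ == _); rewrite ?mulr1 ?mulr0.
Qed.

Lemma sum_Ksum (a : ptypes gT -> int) z :
  (\sum_(nu \in [set: ptypes gT]%classic) Ksum n nu *~ a nu) z = a (mtype z).
Proof.
pose A := [fset mtype x | x in {: wreath gT n}]%fset.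
rewrite (@fsbigTE _ _ _ _ A) => [|nu nuA]; last first.
  suff -> : Ksum n nu = 0 by rewrite mul0rz.
  apply/ffunP => x; rewrite KsumE ffunE; case: eqP => // xnu.
  by case/imfsetP: nuA; exists x.
have zA : mtype z \in A by apply/imfsetP; exists z.
have evalz (f : gring (wreath gT n)) (i : int) : (f *~ i) z = f z *~ i.
  by case: i => q; rewrite -?[f *~ Negz q]/(- (f *+ q.+1)) ?ffunE ffunMnE.
rewrite sum_ffunE (big_fsetD1 _ zA) /= evalz KsumE eqxx big1_fset ?addr0.
  by rewrite intz.
by move=> nu; rewrite !inE evalz KsumE eq_sym => /andP[/negPf -> _] _; rewrite mul0rz.
Qed.

Lemma structure_const_factors lam mu z :
  structure_const n lam mu (mtype z) = #|factors lam mu z|%:R.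
Proof.
rewrite /structure_const; case: xgetP => [a _ /= aP|noa].
  by rewrite -gconv_Ksum aP sum_Ksum.
pose a (nu : ptypes gT) : int :=
  if [pick y : wreath gT n | mtype y == nu] is Some y
  then #|factors lam mu y|%:R else 0.
case: (noa a); apply/ffunP => y; rewrite gconv_Ksum sum_Ksum /a.
case: pickP => [y' /eqP|/(_ y)]; last by rewrite eqxx.
by move/eq_mtype_conj => [w <-]; rewrite card_factors_conj.
Qed.

End Factorizations.

(** * Counting factorizations by their support *)

Lemma wsuppM (gT : finGroupType) n (x y : wreath gT n) i :
  i \notin wsupp x -> i \notin wsupp y -> i \notin wsupp (x * y).
Proof.
move=> /wsuppPn[sx gx] /wsuppPn[sy gy].
have sVi : (wperm x)^-1 i = i by rewrite -{1}sx permK.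
by rewrite inE wpermM sy sx wcoordM gx sVi gy mulg1 !eqxx.
Qed.

Lemma wsuppV (gT : finGroupType) n (x : wreath gT n) : wsupp x^-1 = wsupp x.
Proof.
have sub (y : wreath gT n) i : i \notin wsupp y -> i \notin wsupp y^-1.
  move=> /wsuppPn[sy gy].
  have sVi : (wperm y)^-1 i = i by rewrite -{1}sy permK.
  by rewrite inE /= sVi ffunE sy gy invg1 !eqxx.
apply/setP => i; apply/idP/idP; apply: contraLR; first exact: sub.
by rewrite -{2}[x]invgK; apply: sub.
Qed.

Section Supports.
Variables (gT : finGroupType) (lam mu : ptypes gT) (N : nat) (z0 : wreath gT N).
Hypothesis z0_full : wsupp z0 = [set: 'I_N].

(** z0 as an element of Γ_(N + m). *)
Definition target m : wreath gT (N + m) := push (@lshift_inj N m) z0.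

(** The part of the support lying beyond N, shifted to {0..m-1}. *)
Definition outer m (x : wreath gT (N + m)) : {set 'I_m} :=
  [set j | rshift N j \in wsupp x].

(** The number of factorizations of z0 in Γ_(N + k) whose support contains
    every index beyond N. *)
Definition outer_count k : nat :=
  #|[set x in factors lam mu (target k) | outer x == [set: 'I_k]]|.

Section Spread.
Variables (m : nat) (S : {set 'I_m}).

(** The injection that is the identity below N and lists S above. *)
Definition spread (i : 'I_(N + #|S|)) : 'I_(N + m) :=
  match split i with
  | inl a => lshift m a
  | inr b => rshift N (enum_val b)
  end.

Lemma spread_lshift a : spread (lshift _ a) = lshift m a.
Proof. by rewrite /spread (unsplitK (inl a)). Qed.

Lemma spread_rshift b : spread (rshift _ b) = rshift N (enum_val b).
Proof. by rewrite /spread (unsplitK (inr b)). Qed.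

Lemma spread_inj : injective spread.
Proof.
move=> i j; case: (split_ordP i) => a ->; case: (split_ordP j) => b ->;
  rewrite ?spread_lshift ?spread_rshift => /eqP.
- by rewrite (inj_eq (@lshift_inj _ _)) => /eqP ->.
- by rewrite eq_lrshift.
- by rewrite eq_rlshift.
by rewrite (inj_eq (@rshift_inj _ _)) => /eqP/enum_val_inj ->.
Qed.

Lemma push_target : push spread_inj (target #|S|) = target m.
Proof. by apply: push_comp => a /=; rewrite spread_lshift. Qed.

Lemma outer_push x : outer (push spread_inj x) = [set enum_val j | j in outer x].
Proof.
apply/setP => j; rewrite inE wsupp_push; apply/imsetP/imsetP => [[i xi ji]|[b xb ->]].
  move: xi ji; case: (split_ordP i) => a -> xa /eqP.
    by rewrite spread_lshift eq_rlshift.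
  by rewrite spread_rshift (inj_eq (@rshift_inj _ _)) => /eqP ->; exists a; rewrite ?inE // in xa *.
by exists (rshift N b); rewrite ?spread_rshift //; rewrite inE in xb.
Qed.

(** The number of factorizations with prescribed support beyond N depends only
    on the size of that support. *)
Lemma card_outer :
  #|[set x in factors lam mu (target m) | outer x == S]| = outer_count #|S|.
Proof.
have SE : [set enum_val j | j in [set: 'I_#|S|]] = S.
  apply/setP => j; apply/imsetP/idP => [[i _ ->]|jS]; first exact: enum_valP.
  by exists (enum_rank_in jS j); rewrite ?inE ?enum_rankK_in.
have pushF x : (push spread_inj x \in factors lam mu (target m))
    = (x \in factors lam mu (target #|S|)).
  by rewrite !inE -push_target -pushV -pushM !mtype_push.
rewrite /outer_count -[RHS](card_imset _ (@push_inj _ _ _ _ spread_inj)); apply: eq_card => x.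
rewrite inE; apply/andP/imsetP => [[xF /eqP xS]|[y]]; last first.
  by rewrite inE => /andP[yF /eqP yS] ->; rewrite pushF yF outer_push yS SE.
have [|y yx] := @push_surj _ _ _ _ spread_inj x.
  move=> i xi; apply/codomP; case: (split_ordP i) xi => a -> xa.
    by exists (lshift _ a); rewrite spread_lshift.
  have aS : a \in S by rewrite -xS inE.
  by exists (rshift _ (enum_rank_in aS a)); rewrite spread_rshift enum_rankK_in.
exists y => //; rewrite inE -pushF yx xF; apply/eqP.
apply: (imset_inj (@enum_val_inj _ _)).
by rewrite -outer_push yx xS SE.
Qed.

End Spread.

Lemma card_factors m :
  #|factors lam mu (target m)| = \sum_(k < m.+1) 'C(m, k) * outer_count k.
Proof.
rewrite -sum1_card (partition_big (@outer m) xpredT) //=.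
rewrite (eq_bigr (fun S : {set 'I_m} => outer_count #|S|)) => [|S _]; last first.
  by rewrite sum1dep_card card_outer.
have le_m (S : {set 'I_m}) : #|S| < m.+1 by rewrite ltnS -[m in _ <= m]card_ord max_card.
rewrite (partition_big (fun S => Ordinal (le_m S)) xpredT) //=.
apply: eq_bigr => k _.
rewrite (eq_bigr (fun=> outer_count k)) => [|S /eqP <- //].
rewrite sum_nat_const; congr (_ * _)%N.
have -> : 'C(m, k) = #|[set A : {set 'I_m} | #|A| == k]| by rewrite card_draws card_ord.
apply: eq_card => S.
by rewrite [RHS]inE.
Qed.

(** The second factor is trivial wherever the first factor and z0 are, and one of
    the factors is nontrivial wherever z0 is. *)
Lemma card_wsupp_factors m (x : wreath gT (N + m)) :
  #|wsupp x :|: wsupp (x^-1 * target m)| = N + #|outer x|.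
Proof.
have targetL a : lshift m a \in wsupp (target m).
  by rewrite wsupp_push z0_full imset_f ?inE.
have targetR b : rshift N b \notin wsupp (target m).
  rewrite wsupp_push; apply/imsetP => -[a _ /eqP].
  by rewrite eq_rlshift.
have -> : wsupp x :|: wsupp (x^-1 * target m)
    = [set lshift m a | a in [set: 'I_N]] :|: [set rshift N b | b in outer x].
  apply/setP => i; rewrite !finset.in_setU; case: (split_ordP i) => j ->.
    rewrite [X in _ = X || _]imset_f ?in_setT //; move: (targetL j); apply: contraLR.
    rewrite negb_or => /andP[jx jxt]; rewrite -(mulKVg x (target m)).
    exact: wsuppM.
  have -> : (rshift N j \in [set rshift N b | b in outer x]) = (j \in outer x).
    by rewrite mem_imset //; apply: rshift_inj.
  have -> : (rshift N j \in [set lshift m a | a in [set: 'I_N]]) = false.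
    by apply/imsetP => -[a _ /eqP]; rewrite eq_rlshift.
  rewrite [j \in outer x]inE orFb; apply/orb_idr; apply: contraLR => jx.
  by apply: wsuppM; rewrite ?wsuppV ?targetR.
rewrite cardsU (_ : _ :&: _ = finset.set0) ?cards0 ?subn0.
  rewrite !card_imset ?cardsT ?card_ord //; [exact: rshift_inj|exact: lshift_inj].
apply/setP => i; rewrite inE [RHS]inE; apply/andP => -[/imsetP[a _ ->] /imsetP[b _ /eqP]].
by rewrite eq_lrshift.
Qed.

End Supports.

(** * Supports of tuples *)

Section Ncard.
Variable gT : finGroupType.
Implicit Types (nu : ptypes gT).

Lemma embed_moves n (x : wreath gT n) j :
  gperm (embed x) j <> j \/ gcoord (embed x) j <> 1 <->
  exists2 i, i \in wsupp x & j = i :> nat.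
Proof.
rewrite /= /ext_perm /ext_coord.
split=> [|[i + ->]]; last first.
  by rewrite valK inE => /orP[/eqP xi|/eqP xi]; [left => /val_inj|right].
case: insubP => [i _ <-|_ []//] xi; exists i => //.
by rewrite inE; apply/orP; case: xi => xi; [left|right]; apply/eqP => // /(congr1 val).
Qed.

Lemma Ncard_image r (t : r.-tuple (ginf gT)) n (A : {set 'I_n}) :
  (forall j, Nset [set` t]%classic j <-> exists2 i, i \in A & j = i :> nat) ->
  Ncard t = #|A|.
Proof.
move=> NA; rewrite /Ncard.
have -> : fset_set (Nset [set` t]%classic) = [fset nat_of_ord i | i in A]%fset.
  apply/fsetP => j; rewrite (in_fset_set (@Nset_finite _ _ t)).
  apply/idP/imfsetP => [|/= jA]; first by rewrite inE => /NA.
  by rewrite inE; apply/NA.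
by rewrite card_imfset -?cardE //; apply: val_inj.
Qed.

Lemma Ncard_embed2 n (x y : wreath gT n) :
  Ncard [tuple embed x; embed y] = #|wsupp x :|: wsupp y|.
Proof.
apply: Ncard_image => j; split=> [[w /= + /=]|[i]].
  rewrite !inE => /orP[] /eqP -> /embed_moves[i xi ->]; exists i => //.
    by rewrite finset.in_setU xi.
  by rewrite finset.in_setU xi orbT.
rewrite finset.in_setU => /orP[] xi ji.
  by exists (embed x); rewrite /= ?inE ?eqxx //; apply/embed_moves; exists i.
by exists (embed y); rewrite /= ?inE ?eqxx ?orbT //; apply/embed_moves; exists i.
Qed.

Lemma Ncard_embed1 n (x : wreath gT n) : Ncard [tuple embed x] = #|wsupp x|.
Proof.
apply: Ncard_image => j; split=> [[w /= + /=]|[i xi ji]].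
  by rewrite inE => /eqP -> /embed_moves.
by exists (embed x); rewrite /= ?inE ?eqxx //; apply/embed_moves; exists i.
Qed.

Lemma Ncard_Kinf nu x : Kinf nu x -> Ncard [tuple x] = pweight nu.
Proof.
have [z [znu zfull]] := mtype_exists nu => xnu.
have [w <-] := Kinf_conjP (iffRL (Kinf_embed nu z) znu) xnu.
have -> : [tuple embed z ^ w] = tconj [tuple embed z] w by apply: val_inj.
by rewrite Ncard_conj Ncard_embed1 zfull cardsT card_ord.
Qed.

Lemma card_wsupp nu n (x : wreath gT n) : mtype x = nu -> #|wsupp x| = pweight nu.
Proof. by move=> xnu; rewrite -Ncard_embed1 (@Ncard_Kinf nu) // Kinf_embed. Qed.

Lemma Nclass_Kclass nu : Nclass (Kclass nu) = pweight nu.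
Proof.
rewrite /Nclass; case: xgetP => [t _ [x xnu <-]|noK]; first exact: Ncard_Kinf.
have [z [znu _]] := mtype_exists nu.
by case: (noK [tuple embed z]); exists (embed z) => //; apply/Kinf_embed.
Qed.

End Ncard.

(** * Classes of pairs *)

Section PairClasses.
Variables (gT : finGroupType) (lam mu nu : ptypes gT).
Variable z0 : wreath gT (pweight nu).
Hypotheses (z0nu : mtype z0 = nu) (z0_full : wsupp z0 = [set: 'I_(pweight nu)]).
Local Notation cnt := (outer_count lam mu z0).

Lemma mtype_target m : mtype (target z0 m) = nu.
Proof. by rewrite mtype_push. Qed.

Lemma embed_target m : embed (target z0 m) = embed z0.
Proof. exact: embed_push. Qed.

Lemma outer_count_eq0 k : pweight lam < k -> cnt k = 0.
Proof.
move=> k_gt; apply/eqP; rewrite cards_eq0; apply/eqP/setP => x.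
rewrite inE [RHS]inE; apply/andP => -[]; rewrite inE => /andP[/eqP xlam _] /eqP xo.
suff : #|outer x| <= #|wsupp x|.
  by rewrite xo cardsT card_ord (card_wsupp xlam) leqNgt k_gt.
rewrite -(card_imset _ (@rshift_inj (pweight nu) k)) subset_leq_card //.
by apply/fintype.subsetP => _ /imsetP[j + ->]; rewrite inE.
Qed.

Lemma tconj2 (x y z : ginf gT) : tconj [tuple x; y] z = [tuple x ^ z; y ^ z].
Proof. exact: val_inj. Qed.

Lemma outer_count_pair_class k : 0 < cnt k ->
  exists2 C, pair_class lam mu nu C & Nclass C = (pweight nu + k)%N.
Proof.
case/card_gt0P=> x; rewrite !inE => /andP[/andP[/eqP xlam /eqP ymu] /eqP xo].
set y := x^-1 * _ in ymu.
pose t := [tuple embed x; embed y].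
pose C := [set tconj t z | z in setT]%classic.
have Ccl : tclass C by exists t.
have Ct : C t by exists 1 => //; rewrite tconj2 !conjg1.
exists C; last first.
  by rewrite (NclassE Ccl Ct) Ncard_embed2 card_wsupp_factors // xo cardsT card_ord.
split=> // x' y' [z _]; rewrite tconj2 => /(congr1 val) [<- <-].
rewrite -conjMg -embedM mulKVg; split; apply: Kinf_conj; apply/Kinf_embed => //.
exact: mtype_target.
Qed.

Lemma pair_class_outer_count C : pair_class lam mu nu C ->
  exists2 k, 0 < cnt k & Nclass C = (pweight nu + k)%N.
Proof.
case=> Ccl CK; case: (Ccl) CK => t CE CK.
have Ct : C t by rewrite CE; exists 1 => //; apply: val_inj; rewrite /= (eq_map (@conjg1 _)) map_id.
have [x [y txy]] : exists x y, t = [tuple x; y].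
  case/tupleP: t {CE Ct} => x t; case/tupleP: t => y t; rewrite (tuple0 t).
  by exists x, y; apply: val_inj.
rewrite {t}txy in CE Ct.
have [_ _ xynu] := CK _ _ Ct.
(* Conjugate the pair so that its product becomes z0. *)
have [w xyw] := Kinf_conjP xynu (iffRL (Kinf_embed nu z0) z0nu).
have Cw : C [tuple x ^ w; y ^ w] by rewrite CE; exists w => //; apply: tconj2.
have [xlam ymu _] := CK _ _ Cw.
rewrite (NclassE Ccl Cw).
rewrite conjMg in xyw; move: (x ^ w) (y ^ w) xyw xlam ymu => x' y' xy xlam ymu.
have yE : y' = x'^-1 * embed z0 by rewrite -xy mulKg.
have [m [X [_ [XE _]]]] := embed_pair (pweight nu) x' x'.
rewrite -XE -(embed_target m) -embedV -embedM in yE.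
exists #|outer X|; last by rewrite yE -XE Ncard_embed2 card_wsupp_factors.
rewrite -card_outer; apply/card_gt0P; exists X.
rewrite !inE eqxx andbT; apply/andP; split; apply/eqP/Kinf_embed.
  by rewrite XE.
by rewrite -yE.
Qed.

End PairClasses.

(** * Binomial polynomials *)

Section BinomialPolynomial.
Local Open Scope ring_scope.
Variable N : nat.

(** The binomial coefficient C(X - N, k), as a polynomial in X of degree k. *)
Definition binp (k : nat) : {poly rat} :=
  (k`!%:R)^-1 *: \prod_(i < k) ('X - (N + i)%:R%:P).

Lemma size_binp k : size (binp k) = k.+1.
Proof.
rewrite size_scale; last by rewrite invr_eq0 pnatr_eq0 -lt0n fact_gt0.
by rewrite size_prod_XsubC -sum1_size big_const_ord iter_addn_0 mul1n.
Qed.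

Lemma horner_binp k m : (binp k).[(N + m)%:R] = 'C(m, k)%:R.
Proof.
have -> : 'C(m, k)%:R = (k`!%:R)^-1 * (m ^_ k)%:R :> rat.
  rewrite -bin_ffact natrM mulrCA mulVf ?mulr1 //.
  by rewrite pnatr_eq0 -lt0n fact_gt0.
rewrite hornerZ horner_prod; congr (_ * _).
elim: k => [|k IHk]; first by rewrite big_ord0.
rewrite big_ord_recr /= IHk ffactnSr natrM hornerXsubC.
have [km|mk] := leqP k m; last by rewrite ffact_small // !mul0r.
by rewrite natrB // !natrD opprD addrACA subrr add0r.
Qed.

Lemma sum_ord_widen (V : nmodType) (F : nat -> V) a b :
    (forall k, (a <= k)%N -> F k = 0) -> (a <= b)%N ->
  \sum_(k < b) F k = \sum_(k < a) F k.
Proof.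
move=> F0 ab; rewrite -!(big_mkord xpredT) (big_cat_nat (leq0n a) ab) //=.
rewrite [X in _ + X]big_nat_cond [X in _ + X]big1 ?addr0 // => k.
by rewrite andbT => /andP[/F0].
Qed.

Lemma size_sum_binp (c : nat -> nat) d : c d != 0%N ->
  size (\sum_(k < d.+1) (c k)%:R *: binp k) = d.+1.
Proof.
move=> cd; rewrite big_ord_recr /= addrC size_polyDl.
  by rewrite size_scale ?size_binp // pnatr_eq0.
rewrite size_scale ?size_binp ?pnatr_eq0 // ltnS.
apply: (leq_trans (size_sum _ _ _)); apply/bigmax_leqP => k _.
by apply: (leq_trans (size_scale_leq _ _)); rewrite size_binp.
Qed.

End BinomialPolynomial.

Local Open Scope ring_scope.

Lemma poly_eq_large (p q : {poly rat}) (N : nat) :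
  (forall n, (N <= n)%N -> p.[n%:R] = q.[n%:R]) -> p = q.
Proof.
move=> pq; apply/eqP; rewrite -subr_eq0; apply/negPn/negP => pq0.
pose rs : seq rat := [seq i%:R | i <- iota N (size (p - q))].
suff : (size rs < size (p - q)%R)%N by rewrite size_map size_iota ltnn.
apply: max_poly_roots => //; last first.
  by rewrite map_inj_uniq ?iota_uniq // => i j /eqP; rewrite eqr_nat => /eqP.
apply/allP => _ /mapP[i + ->]; rewrite mem_iota => /andP[Ni _].
by rewrite /root hornerD hornerN pq ?subrr.
Qed.

Local Open Scope classical_set_scope.

Theorem proposition2p9 (gT : finGroupType) (lam mu nu : ptypes gT) :
  exists f : {poly rat},
    unique (fun p : {poly rat} =>
      forall n : nat, (pnorm nu + size (nu (conjcl1 gT)) <= n)%N ->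
        p.[n%:R] = (structure_const n lam mu nu)%:~R) f /\
    let D : set int :=
      [set (Nclass C)%:Z - (Nclass (Kclass nu))%:Z
        | C in pair_class lam mu nu] in
    (exists d : nat, [/\ size f = d.+1, D d%:Z & ubound D d%:Z]) \/
    (f = 0 /\ D = set0).
Proof.
have [z0 [z0nu z0_full]] := mtype_exists nu.
rewrite -/(pweight nu); set N := pweight nu in z0 z0nu z0_full *.
pose c := outer_count lam mu z0.
pose d0 := pweight lam.
have c0 k : (d0 < k)%N -> c k = 0%N by apply: outer_count_eq0.
pose f := \sum_(k < d0.+1) (c k)%:R *: binp N k.
have fE n : (N <= n)%N -> f.[n%:R] = (structure_const n lam mu nu)%:~R.
  move=> /subnKC <-; move: (n - N)%N => m.
  rewrite -(mtype_target z0nu m) structure_const_factors card_factors.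
  rewrite rmorph_nat natr_sum /f horner_sum.
  under [LHS]eq_bigr => k _ do rewrite hornerZ horner_binp -natrM mulnC.
  (* The summands with k > d0 or k > m vanish, so both sums may be taken up to
     d0 + m. *)
  pose F k : rat := ('C(m, k) * c k)%:R.
  rewrite -(@sum_ord_widen _ F _ (d0 + m).+1) ?ltnS ?leq_addr //.
    rewrite -[RHS](@sum_ord_widen _ F _ (d0 + m).+1) ?ltnS ?leq_addl // => k mk.
    by rewrite /F bin_small.
  by move=> k /c0 ck0; rewrite /F ck0 muln0.
have DE (e : int) : [set (Nclass C)%:Z - (Nclass (Kclass nu))%:Z
        | C in pair_class lam mu nu] e <-> exists2 k, (0 < c k)%N & e = k%:Z.
  rewrite Nclass_Kclass; split=> [[C CP <-]|[k ck ->]].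
    have [k ck ->] := pair_class_outer_count z0nu z0_full CP.
    by exists k => //; rewrite PoszD addrAC subrr add0r.
  have [C CP CN] := outer_count_pair_class z0nu z0_full ck.
  by exists C => //; rewrite CN PoszD addrAC subrr add0r.
exists f; split.
  split=> [//|p pE]; apply: (@poly_eq_large _ _ N) => n Nn.
  by rewrite fE ?pE.
move=> D; have [exc|noc] := pselect (exists k, (0 < c k)%N).
  have le_d0 k : (0 < c k)%N -> (k <= d0)%N.
    by move=> ck; rewrite leqNgt; apply: contraL ck => /c0 ->.
  left; case: (ex_maxnP exc le_d0) => d cd d_max; exists d; split.
  - rewrite /f (@sum_ord_widen _ (fun k => (c k)%:R *: binp N k) d.+1).
    + by rewrite size_sum_binp // -lt0n.
    + move=> k dk; case: (posnP (c k)) => [->|/d_max]; first by rewrite scale0r.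
      by rewrite leqNgt dk.
    by rewrite ltnS le_d0.
  - by apply/DE; exists d.
  by move=> e /DE[k /d_max kd ->]; rewrite lez_nat.
have c_eq0 k : c k = 0%N.
  by case: (posnP (c k)) => // ck; case: noc; exists k.
right; split; first by rewrite /f big1 // => k _; rewrite c_eq0 scale0r.
by apply/seteqP; split=> // e /DE[k]; rewrite c_eq0.
Qed.
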